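(* Let $\lambda>0$. The independent random walk process on two sites is self-dual with self-duality function $D(x,n)=C(x_1,n_1)\,C(x_2,n_2)$, where $C(x,n)=C_n(x)$ and $$C_n(x)={}_2F_0\!\left(-n,-x;-;-\tfrac1\lambda\right),\qquad x,n\in\mathbb{N}_0,$$ are the Charlier polynomials. That is, with $L$ the generator of the process on two sites, $$[L D(\cdot,n)](x)=[L D(x,\cdot)](n)\qquad\text{for all } x=(x_1,x_2),\ n=(n_1,n_2)\in\mathbb{N}_0^2 .$$
   Context: $\mathbb{N}_0=\{0,1,2,\dots\}$. The independent random walk process (IRW) on two sites is the Markov jump process on $\mathbb{N}_0^2$ with generator $$(Lf)(x_1,x_2)=x_1\left[f(x_1-1,x_2+1)-f(x_1,x_2)\right]+x_2\left[f(x_1+1,x_2-1)-f(x_1,x_2)\right],$$ where a term with vanishing rate is understood to be zero; $L$ acts pointwise on functions on $\mathbb{N}_0^2$ by this formula. A process with generator $L$ and state space $\mathcal{S}$ is called self-dual with self-duality function $D:\mathcal{S}\times\mathcal{S}\to\mathbb{R}$ if $[LD(\cdot,y)](x)=[LD(x,\cdot)](y)$ for all $x,y\in\mathcal{S}$; on the left $L$ acts on $D$ as a function of the first argument, on the right as a function of the second argument. The hypergeometric function is here the finite sum $$ {}_2F_0\!\left(-n,-x;-;-\tfrac1\lambda\right)=\sum_{i=0}^{\min(n,x)}(-n)_i(-x)_i\frac{(-1/\lambda)^{i}}{i!},\qquad (a)_i=a(a+1)\cdots(a+i-1),\ (a)_0=1 .$$ *)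

(* Defs.v *)
From mathcomp Require Import all_boot all_order all_algebra.
From mathcomp Require Import reals.

Set Implicit Arguments.
Unset Strict Implicit.
Unset Printing Implicit Defensive.

Import Order.TTheory GRing.Theory Num.Theory.
Local Open Scope ring_scope.

(* When x.1 = 0 (resp. x.2 = 0) the truncated predecessor is harmless: the
   rate in front vanishes, so the whole term is zero. *)
Definition irw_generator (R : realType) (f : nat * nat -> R) (x : nat * nat)
    : R :=
  x.1%:R * (f (x.1.-1, x.2.+1) - f x) + x.2%:R * (f (x.1.+1, x.2.-1) - f x).

(* A process is represented by its generator L, acting pointwise on functions
   on the state space. *)
Definition self_dual (R : realType) (S : Type) (L : (S -> R) -> S -> R)
    (D : S -> S -> R) : Prop :=
  forall x y : S, L (fun x' => D x' y) x = L (fun y' => D x y') y.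

(* The rising factorial (a)_i = a (a + 1) ... (a + i - 1). *)
Definition pochhammer (R : realType) (a : R) (i : nat) : R :=
  \prod_(k < i) (a + k%:R).

(* The terminating series 2F0(-n, -x; -; z). *)
Definition hyp2F0 (R : realType) (n x : nat) (z : R) : R :=
  \sum_(0 <= i < (minn n x).+1)
    pochhammer (- n%:R) i * pochhammer (- x%:R) i * (z ^+ i / i`!%:R).

Definition charlier (R : realType) (lambda : R) (n x : nat) : R :=
  hyp2F0 n x (- (1 / lambda)).

Definition irw_duality (R : realType) (lambda : R) (x n : nat * nat) : R :=
  charlier lambda n.1 x.1 * charlier lambda n.2 x.2.

(* Main.v *)
Require Import Defs.
From mathcomp Require Import all_boot all_order all_algebra.
From mathcomp Require Import reals.
From mathcomp Require Import ring.

(** With [z = -1/lambda] and [H(n, x) = 2F0(-n, -x; -; z)], which is symmetric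
    in [n] and [x], put [P = x H(n, x-1)] and [N = n H(n-1, x)].  Comparing
    coefficients of [z^i] gives [H(n, x+1) = H(n, x) + z N],
    [H(n+1, x) = H(n, x) + z P] and [P - N = (x - n) H(n, x)].  Substituting
    these for both sites, the terms [z (P1 N2 + N1 P2)] on the two sides of the
    duality relation agree, and the last identity accounts for the rest. *)

Set Implicit Arguments.
Unset Strict Implicit.
Unset Printing Implicit Defensive.

Import Order.TTheory GRing.Theory Num.Theory.
Local Open Scope ring_scope.

(** For [i > n] the factor [n ^_ i] vanishes, so the subtraction can be taken in the ring. *)
Lemma natr_ffactSr (R : pzRingType) (n i : nat) :
  (n ^_ i.+1)%:R = (n ^_ i)%:R * (n%:R - i%:R) :> R.
Proof.
rewrite ffactnSr natrM; have [le_in|lt_ni] := leqP i n; first by rewrite natrB.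
by rewrite ffact_small // !mul0r.
Qed.

Lemma natr_ffactS (R : pzSemiRingType) (n i : nat) :
  n%:R * (n.-1 ^_ i)%:R = (n ^_ i.+1)%:R :> R.
Proof. by rewrite ffactnS natrM. Qed.

Lemma pochhammerN (R : realType) (n i : nat) :
  pochhammer (- n%:R : R) i = (-1) ^+ i * (n ^_ i)%:R.
Proof.
rewrite /pochhammer; elim: i => [|i IH]; first by rewrite big_ord0 mulr1.
by rewrite big_ord_recr /= IH natr_ffactSr exprS; ring.
Qed.

(** The signs of the two Pochhammer symbols cancel, and the terms past [minn n x] vanish. A free
    length [m] lets series with different parameters be compared termwise. *)
Lemma hyp2F0E (R : realType) (n x m : nat) (z : R) : (minn n x < m)%N ->
  hyp2F0 n x z =
  \sum_(i < m) (n ^_ i)%:R * (x ^_ i)%:R * (z ^+ i / i`!%:R).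
Proof.
move=> lt_m; rewrite -(subnKC lt_m) big_split_ord /= addrC big1 => [|i _].
  rewrite add0r /hyp2F0 big_mkord; apply: eq_bigr => i _.
  congr (_ * _).
  by rewrite !pochhammerN mulrACA -exprMn mulrNN mulr1 expr1n mul1r.
have : (minn n x < (minn n x).+1 + i)%N by rewrite addSn ltnS leq_addr.
by rewrite gtn_min => /orP[] /ffact_small ->; rewrite ?(mul0r, mulr0).
Qed.

Lemma hyp2F0C (R : realType) (n x : nat) (z : R) : hyp2F0 n x z = hyp2F0 x n z.
Proof.
by rewrite /hyp2F0 minnC; apply: eq_bigr => i _; congr (_ * _); apply: mulrC.
Qed.

Lemma hyp2F0Sr (R : realType) (n x : nat) (z : R) :
  hyp2F0 n x.+1 z = hyp2F0 n x z + z * (n%:R * hyp2F0 n.-1 x z).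
Proof.
(* One extra term here: the factor [z] shifts the last series by one index. *)
rewrite (@hyp2F0E _ n x.+1 n.+2) ?gtn_min ?leqnSn //.
rewrite (@hyp2F0E _ n x n.+2) ?gtn_min ?leqnSn //.
rewrite (@hyp2F0E _ n.-1 x n.+1) ?gtn_min ?ltnS ?leq_pred //.
rewrite !(big_ord_recl n.+1) !ffactn0 -addrA; congr (_ + _).
rewrite !mulr_sumr -big_split; apply: eq_bigr => i _.
(* The core is [x.+1 ^_ i.+1 - x ^_ i.+1 = i.+1 * x ^_ i]. *)
rewrite lift0 ffactSS factS (natrM _ x.+1) (natrM _ i.+1) (natr_ffactSr _ x).
rewrite -(natr_ffactS _ n) exprS /=.
have fact_neq0 : i`!%:R != 0 :> R by rewrite pnatr_eq0 -lt0n fact_gt0.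
by field; rewrite fact_neq0 nat1r pnatr_eq0.
Qed.

Lemma hyp2F0Sl (R : realType) (n x : nat) (z : R) :
  hyp2F0 n.+1 x z = hyp2F0 n x z + z * (x%:R * hyp2F0 n x.-1 z).
Proof. by rewrite hyp2F0C hyp2F0Sr hyp2F0C (hyp2F0C x.-1). Qed.

Lemma hyp2F0_pred (R : realType) (n x : nat) (z : R) :
  x%:R * hyp2F0 n x.-1 z =
  n%:R * hyp2F0 n.-1 x z + (x%:R - n%:R) * hyp2F0 n x z.
Proof.
rewrite !(@hyp2F0E _ _ _ n.+1) ?gtn_min ?ltnS ?leqnn ?leq_pred //.
rewrite !mulr_sumr -big_split /=; apply: eq_bigr => i _.
(* Both give [x * x.-1 ^_ i = (x - i) * x ^_ i], for [x] and for [n]; then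
   [(x - i) - (n - i) = x - n]. *)
have ex := natr_ffactS R x i; have en := natr_ffactS R n i.
rewrite !natr_ffactSr in ex en; ring: ex en.
Qed.

Theorem theorem4p10 (R : realType) (lambda : R) (hlambda : 0 < lambda) :
  self_dual (@irw_generator R) (irw_duality lambda).
Proof.
move=> [x1 x2] [n1 n2]; rewrite /irw_generator /irw_duality /charlier /=.
move: (- (1 / lambda)) => z; rewrite !hyp2F0Sr !hyp2F0Sl.
have e1 := hyp2F0_pred n1 x1 z; have e2 := hyp2F0_pred n2 x2 z.
ring: e1 e2.
Qed.
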